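(* Let $G = H_3(\mathbb{Z})$ be the discrete Heisenberg group with generators $a,b$, and consider $a-b\in\mathbb{Z}[G]$. Let $p$ be an odd prime and, for $i\ge 1$, set $N_i = (\mathrm{Id}_3 + p^i\,\mathrm{Mat}_3(\mathbb{Z}))\cap G \unlhd G$; consider the residual chain $G\unrhd N_1\unrhd N_2\unrhd\cdots$ and set $G_i = G/N_i\cong H_3(\mathbb{Z}/p^i\mathbb{Z})$. Let $A_i\in\mathrm{Mat}_{p^{3i}}(\mathbb{Z})$ be the matrix that represents the action of $a-b$ on $\mathbb{C}[G_i]\cong\mathbb{C}^{p^{3i}}$ by right multiplication, and let $\mu_{A_i}$ be the regularized eigenvalue measure of $A_i$. Then $$\lim_{i\to\infty}\mu_{A_i}(\{0\})=\frac{p}{p+1}.$$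
   Context: For $R=\mathbb{Z}$ or $R=\mathbb{Z}/n\mathbb{Z}$, $H_3(R)$ is the subgroup of $\mathrm{GL}_3(R)$ generated by $$a=\begin{pmatrix}1&1&0\\0&1&0\\0&0&1\end{pmatrix},\qquad b=\begin{pmatrix}1&0&0\\0&1&1\\0&0&1\end{pmatrix}.$$ $G$ acts on $\mathbb{C}[G_i]$ by right multiplication through the quotient map $G\to G_i$, and this action is extended linearly to $\mathbb{Z}[G]$. The regularized eigenvalue measure of $A_i$ is $\mu_{A_i}=\frac{1}{|G_i|}\sum_{j=1}^{|G_i|}\delta_{\lambda_j}$, where $\lambda_1,\dots,\lambda_{|G_i|}$ are the eigenvalues of $A_i$ counted with algebraic multiplicity, $\delta_z$ is the Dirac measure at $z\in\mathbb{C}$, and $|G_i|=p^{3i}$. *)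

(* Defs.v *)
From HB Require Import structures.
From mathcomp Require Import all_boot all_order all_algebra all_fingroup.
From mathcomp Require Import generic_quotient complex freeg.
From mathcomp Require Import all_classical all_reals all_analysis.
Import Order.TTheory GRing.Theory Num.Theory.
Import numFieldNormedType.Exports.

Set Implicit Arguments.
Unset Strict Implicit.
Unset Printing Implicit Defensive.

Local Open Scope ring_scope.

Section Generated.
Variables (G : groupType) (s : seq G).

Definition generated : {pred G} :=
  [pred x | `[< forall H : {pred G},
                  group_closed H -> {subset s <= H} -> x \in H >]].

Fact generated_closed : group_closed generated.
Proof.
split=> [|x y /asboolP xs /asboolP ys]; apply/asboolP => H Hc sH.
  exact: Hc.1.
by apply: Hc.2; [apply: xs | apply: ys].
Qed.

Lemma mem_generated x : x \in s -> x \in generated.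
Proof. by move=> xs; apply/asboolP => H _; apply. Qed.

Record subgroup_gen := SubgroupGen { genval : G; _ : genval \in generated }.

HB.instance Definition _ := [isSub for genval].
HB.instance Definition _ := [Choice of subgroup_gen by <:].
HB.instance Definition _ :=
  SubChoice_isSubGroup.Build G generated subgroup_gen generated_closed.

End Generated.

Section QuotientGroup.
Variable G : groupType.
Local Open Scope group_scope.

Record normal_subgroup := NormalSubgroup {
  nsub :> {pred G};
  nsub_closed : group_closed nsub;
  nsub_normal : forall x y, x \in nsub -> x ^ y \in nsub
}.

Variable N : normal_subgroup.

Definition coset_rel : rel G := fun x y => x^-1 * y \in N.

Fact coset_rel_refl : reflexive coset_rel.
Proof. by move=> x; rewrite /coset_rel mulVg; apply: (nsub_closed N).1. Qed.

Let nsubV x : x \in N -> x^-1 \in N.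
Proof.
move=> xN; rewrite -[x^-1]mul1g; apply: (nsub_closed N).2 => //.
exact: (nsub_closed N).1.
Qed.

Let nsubM x y : x \in N -> y \in N -> x * y \in N.
Proof.
by move=> xN yN; rewrite -[y]invgK; apply: (nsub_closed N).2 => //; apply: nsubV.
Qed.

Fact coset_rel_sym : symmetric coset_rel.
Proof.
have h x y : coset_rel x y -> coset_rel y x.
  by move=> /nsubV; rewrite invgM invgK.
by move=> x y; apply/idP/idP; apply: h.
Qed.

Fact coset_rel_trans : transitive coset_rel.
Proof.
move=> y x z xy yz; have := nsubM xy yz.
by rewrite -mulgA mulKVg.
Qed.

Canonical coset_equiv :=
  EquivRel coset_rel coset_rel_refl coset_rel_sym coset_rel_trans.

Definition quotient_group := {eq_quot coset_rel}%qT.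

HB.instance Definition _ := Choice.on quotient_group.
HB.instance Definition _ := Quotient.on quotient_group.
HB.instance Definition _ := EqQuotient.on quotient_group.

Definition quot_proj (x : G) : quotient_group := (\pi_quotient_group x)%qT.

Lemma quot_projP x y :
  reflect (quot_proj x = quot_proj y) (x^-1 * y \in N).
Proof. exact: (@eqquotP _ coset_equiv quotient_group). Qed.

Lemma quot_projK u : quot_proj (repr u) = u.
Proof. exact: reprK. Qed.

Definition quot_one := quot_proj 1.
Definition quot_inv (u : quotient_group) := quot_proj (repr u)^-1.
Definition quot_mul (u v : quotient_group) := quot_proj (repr u * repr v).

Lemma quot_projM x y : quot_proj (x * y) = quot_mul (quot_proj x) (quot_proj y).
Proof.
set x' := repr (quot_proj x); set y' := repr (quot_proj y).
have /quot_projP xx' : quot_proj x = quot_proj x' by rewrite quot_projK.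
have /quot_projP yy' : quot_proj y = quot_proj y' by rewrite quot_projK.
apply/quot_projP.
have -> : (x * y)^-1 * (x' * y') = (x^-1 * x') ^ y * (y^-1 * y').
  by rewrite /conjg invgM !mulgA mulgK.
by apply: nsubM => //; apply: nsub_normal.
Qed.

Lemma quot_projV x : quot_proj x^-1 = quot_inv (quot_proj x).
Proof.
set x' := repr (quot_proj x).
have /quot_projP xx' : quot_proj x' = quot_proj x by rewrite quot_projK.
apply/quot_projP; rewrite invgK -/x'.
have -> : x * x'^-1 = (x'^-1 * x) ^ (x'^-1).
  by rewrite /conjg invgK !mulgA mulgV mul1g.
exact: nsub_normal.
Qed.

Fact quot_mulA : associative quot_mul.
Proof.
move=> u v w; rewrite -(quot_projK u) -(quot_projK v) -(quot_projK w).
by rewrite -!quot_projM mulgA.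
Qed.

Fact quot_mul1 : left_id quot_one quot_mul.
Proof. by move=> u; rewrite -(quot_projK u) -quot_projM mul1g. Qed.

Fact quot_mulr1 : right_id quot_one quot_mul.
Proof. by move=> u; rewrite -(quot_projK u) -quot_projM mulg1. Qed.

Fact quot_mulV : left_inverse quot_one quot_inv quot_mul.
Proof. by move=> u; rewrite -(quot_projK u) -quot_projV -quot_projM mulVg. Qed.

Fact quot_mulrV : right_inverse quot_one quot_inv quot_mul.
Proof. by move=> u; rewrite -(quot_projK u) -quot_projV -quot_projM mulgV. Qed.

HB.instance Definition _ := isGroup.Build quotient_group
  quot_mulA quot_mul1 quot_mulr1 quot_mulV quot_mulrV.

End QuotientGroup.

(* The library's 'GL_n[R] is only available for finite rings R.               *)
Section GeneralLinear.
Variables (n : nat) (R : comUnitRingType).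

Record gl_group := GLGroup { glval : 'M[R]_n; _ : glval \in unitmx }.

HB.instance Definition _ := [isSub for glval].
HB.instance Definition _ := [Choice of gl_group by <:].

Implicit Types g h : gl_group.

Fact gl_unit g : glval g \in unitmx. Proof. exact: valP. Qed.

Fact gl_mul_unit g h : glval g *m glval h \in unitmx.
Proof. by rewrite unitmx_mul !gl_unit. Qed.

Fact gl_inv_unit g : invmx (glval g) \in unitmx.
Proof. by rewrite unitmx_inv gl_unit. Qed.

Definition gl_one := GLGroup (unitmx1 R n).
Definition gl_mul g h := GLGroup (gl_mul_unit g h).
Definition gl_inv g := GLGroup (gl_inv_unit g).

Fact gl_mulA : associative gl_mul.
Proof. by move=> g h k; apply: val_inj; rewrite /= mulmxA. Qed.

Fact gl_mul1 : left_id gl_one gl_mul.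
Proof. by move=> g; apply: val_inj; rewrite /= mul1mx. Qed.

Fact gl_mulr1 : right_id gl_one gl_mul.
Proof. by move=> g; apply: val_inj; rewrite /= mulmx1. Qed.

Fact gl_mulV : left_inverse gl_one gl_inv gl_mul.
Proof. by move=> g; apply: val_inj; rewrite /= mulVmx ?gl_unit. Qed.

Fact gl_mulrV : right_inverse gl_one gl_inv gl_mul.
Proof. by move=> g; apply: val_inj; rewrite /= mulmxV ?gl_unit. Qed.

HB.instance Definition _ := isGroup.Build gl_group
  gl_mulA gl_mul1 gl_mulr1 gl_mulV gl_mulrV.

End GeneralLinear.

Section Heisenberg.
Variable R : comUnitRingType.

Definition mx_of_rows (s : seq (seq R)) : 'M[R]_3 :=
  \matrix_(i, j) nth 0 (nth [::] s i) j.

Definition heis_a_mx :=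
  mx_of_rows [:: [:: 1; 1; 0];
                 [:: 0; 1; 0];
                 [:: 0; 0; 1]].

Definition heis_b_mx :=
  mx_of_rows [:: [:: 1; 0; 0];
                 [:: 0; 1; 1];
                 [:: 0; 0; 1]].

Fact heis_a_unit : heis_a_mx \in unitmx.
Proof.
pose ai := mx_of_rows [:: [:: 1; -1; 0]; [:: 0; 1; 0]; [:: 0; 0; 1]].
suff /mulmx1_unit[] : heis_a_mx *m ai = 1%:M by [].
apply/matrixP => i j; rewrite !mxE !big_ord_recr big_ord0 /= !mxE /=.
case: i => [[|[|[|]]]] //= ?; case: j => [[|[|[|]]]] //= ?;
  by rewrite ?(mulr0, mul0r, mulr1, mul1r, addr0, add0r, addNr, subrr).
Qed.

Fact heis_b_unit : heis_b_mx \in unitmx.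
Proof.
pose bi := mx_of_rows [:: [:: 1; 0; 0]; [:: 0; 1; -1]; [:: 0; 0; 1]].
suff /mulmx1_unit[] : heis_b_mx *m bi = 1%:M by [].
apply/matrixP => i j; rewrite !mxE !big_ord_recr big_ord0 /= !mxE /=.
case: i => [[|[|[|]]]] //= ?; case: j => [[|[|[|]]]] //= ?;
  by rewrite ?(mulr0, mul0r, mulr1, mul1r, addr0, add0r, addNr, subrr).
Qed.

Definition gl_a : gl_group 3 R := GLGroup heis_a_unit.
Definition gl_b : gl_group 3 R := GLGroup heis_b_unit.

Definition heis := subgroup_gen [:: gl_a; gl_b].

HB.instance Definition _ := SubGroup.on heis.

Definition heis_mx (g : heis) : 'M[R]_3 := glval (genval g).

Definition heis_a : heis := SubgroupGen (mem_generated (mem_head _ _)).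
Definition heis_b : heis := SubgroupGen (mem_generated (mem_last _ [:: _])).

Lemma heis_mx_inj : injective heis_mx.
Proof. by move=> g h /val_inj/val_inj. Qed.

Lemma heis_mxM (g h : heis) : heis_mx (g * h)%g = heis_mx g *m heis_mx h.
Proof. by []. Qed.

Lemma heis_mx1 : heis_mx 1%g = 1%:M.
Proof. by []. Qed.

Lemma heis_mxV (g : heis) : heis_mx g^-1%g = invmx (heis_mx g).
Proof. by []. Qed.

Lemma heis_mx_unit (g : heis) : heis_mx g \in unitmx.
Proof. exact: gl_unit. Qed.

End Heisenberg.
Arguments heis_a {R}.
Arguments heis_b {R}.

Section CongruenceQuotient.
Variable n : nat.

Definition congruence_pred : {pred heis int} :=
  [pred g | `[< exists M : 'M[int]_3, heis_mx g = 1%:M + n%:R *: M >]].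

Fact congruence_closed : group_closed congruence_pred.
Proof.
split=> [|g h /asboolP[M gM] /asboolP[M' hM]]; apply/asboolP.
  by exists 0; rewrite scaler0 addr0 heis_mx1.
exists ((M - M') *m invmx (heis_mx h)).
apply: (can_inj (mulmxK (heis_mx_unit h))).
rewrite heis_mxM heis_mxV mulmxKV ?heis_mx_unit // mulmxDl mul1mx scalemxAl.
by rewrite mulmxKV ?heis_mx_unit // gM hM scalerBr addrA addrAC addrK addrC.
Qed.

Fact congruence_normal g h :
  g \in congruence_pred -> (g ^ h)%g \in congruence_pred.
Proof.
case/asboolP=> M gM; apply/asboolP.
exists (invmx (heis_mx h) *m M *m heis_mx h).
rewrite !heis_mxM heis_mxV gM mulmxDl mul1mx mulmxDr mulVmx ?heis_mx_unit //.
by rewrite -scalemxAl -scalemxAr mulmxA.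
Qed.

Definition congruence : normal_subgroup (heis int) :=
  NormalSubgroup congruence_closed congruence_normal.

(* The positivity proof is a parameter of the type so that the finType        *)
(* instance below, which fails for n = 0, can be canonical.                   *)
Definition heis_quo of (0 < n)%N := quotient_group congruence.

Hypothesis n_gt0 : (0 < n)%N.
Local Notation Q := (heis_quo n_gt0).

HB.instance Definition _ := Group.on Q.

Definition heis_quo_code (u : Q) : 'M['I_n]_3 :=
  \matrix_(i, j)
    Ordinal (ltn_pmod `|(heis_mx (repr u) i j %% n)%Z|%N n_gt0).

Fact heis_quo_code_inj : injective heis_quo_code.
Proof.
move=> u v /matrixP uv; rewrite -(quot_projK u) -(quot_projK v).
apply/quot_projP/asboolP; set g := repr u; set h := repr v.
have nz : (n : int) != 0 by rewrite -lt0n.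
pose D := \matrix_(i, j) ((heis_mx h i j - heis_mx g i j) %/ n)%Z : 'M[int]_3.
have ghD : heis_mx h = heis_mx g + n%:R *: D.
  apply/matrixP => i j; rewrite !mxE mulrC natz divzK ?subrKC //.
  rewrite -eqz_mod_dvd; have := uv i j; rewrite !mxE => /(congr1 val) /=.
  have small (m : int) : (`|(m %% n)%Z| %% n)%N = `|(m %% n)%Z|%N.
    rewrite modn_small // -ltz_nat gez0_abs ?modz_ge0 //.
    by rewrite ltz_pmod.
  rewrite !small => e; apply/eqP.
  rewrite -[LHS]gez0_abs ?modz_ge0 // -[RHS]gez0_abs ?modz_ge0 //.
  by rewrite -/g -/h in e *; rewrite e.
exists (invmx (heis_mx g) *m D).
by rewrite heis_mxM heis_mxV ghD mulmxDr mulVmx ?heis_mx_unit // -scalemxAr.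
Qed.

Definition heis_quo_decode (M : 'M['I_n]_3) : option Q :=
  if pselect (exists u, heis_quo_code u = M) is left e then Some (sval (cid e))
  else None.

Fact heis_quo_codeK : pcancel heis_quo_code heis_quo_decode.
Proof.
move=> u; rewrite /heis_quo_decode; case: pselect => [e|[]]; last by exists u.
by congr Some; apply: heis_quo_code_inj; exact: (svalP (cid e)).
Qed.

HB.instance Definition _ := PCanIsCountable heis_quo_codeK.
HB.instance Definition _ : fintype.isFinite Q := PCanIsFinite heis_quo_codeK.

End CongruenceQuotient.

Section RegularAction.
Variables (G : groupType) (Q : finGroupType) (f : G -> Q).

(* Matrices act on row vectors (as always in the library), so that row [x] of *)
(* the matrix of [v |-> v * f g] is the coordinate vector of [x * f g].       *)
Definition rmul_mx (g : G) : 'M[int]_#|Q| :=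
  \matrix_(x, y) (enum_val y == enum_val x * f g)%g%:R.

(* {freeg G / int} is the additive group of Z[G]; no product of Z[G] is used. *)
Definition group_ring_mx (c : {freeg G / int}) : 'M[int]_#|Q| :=
  fglift rmul_mx c.

End RegularAction.

Section EigenvalueMeasure.
Variable R : realType.
Local Notation C := R[i].

(* [C^o] carries the topology of the norm of [C], i.e. the usual one.         *)
Definition borelC := g_sigma_algebraType (@open C^o).

(* The sequence of roots, repeated with multiplicity, of the (monic)          *)
(* characteristic polynomial; the choice of the order is immaterial below.    *)
Definition eigenvalues m (A : 'M[C]_m) : seq C :=
  sval (closed_field_poly_normal (char_poly A)).

Definition eigenvalue_measure m (A : 'M[int]_m)
    : {measure set borelC -> \bar R} :=
  mscale (m%:R^-1)%:nng
    (msum (fun j => \d_((eigenvalues (map_mx intr A))`_j : borelC)) m).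

End EigenvalueMeasure.

Section HeisenbergMatrix.
Variables (p i : nat) (p_pr : prime p).

Lemma heis_pow_gt0 : (0 < p ^ i)%N.
Proof. by rewrite expn_gt0 prime_gt0. Qed.

Definition heis_level : finGroupType := heis_quo heis_pow_gt0.

Definition heis_level_mx : 'M[int]_#|heis_level| :=
  group_ring_mx (@quot_proj _ (congruence (p ^ i)) : heis int -> heis_level)
    (<< heis_a >> - << heis_b >>).

End HeisenbergMatrix.

(* Main.v *)
(* Left multiplication by the abelian subgroup {x = 0} commutes with the action
   of a - b, so with w a primitive n-th root of unity, n = p^i, the group
   algebra of H_3(Z/n) splits into n^2 invariant subspaces of dimension n,
   indexed by the characters (c, d) of the coordinates (z, y). On the (c, d)
   subspace a - b is the cyclic shift minus the diagonal matrix with entries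
   w^(c x + d), so its characteristic polynomial is
   prod_x (X + w^(c x + d)) - 1 = (X^m + w^(d m))^(n/m) - 1, where
   m = n / gcd(c, n) is odd. At 0 this has a root of multiplicity exactly m,
   since its derivative with respect to X^m does not vanish there. Hence 0 has
   multiplicity n * sum_c n / gcd(c, n) as an eigenvalue, and the sum equals
   (p^(2i+1) + 1) / (p + 1). *)
Require Import Defs.
From HB Require Import structures.
From mathcomp Require Import all_boot all_order all_algebra all_fingroup.
From mathcomp Require Import cyclic separable cyclotomic generic_quotient ring.
From mathcomp Require Import complex freeg.
From mathcomp Require Import all_classical all_reals all_analysis.
Import Order.TTheory GRing.Theory Num.Theory.
Import numFieldNormedType.Exports.

Set Implicit Arguments.
Unset Strict Implicit.
Unset Printing Implicit Defensive.

Local Open Scope classical_set_scope.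
Local Open Scope ring_scope.

(** * Determinants and characteristic polynomials: block matrices and cyclic shifts *)

Lemma det_castmx (R : comNzRingType) m n (e e' : m = n) (A : 'M[R]_m) :
  \det (castmx (e, e') A) = \det A.
Proof. by case: n / e e' => e'; rewrite castmx_id. Qed.

Lemma det_mxdiag (R : comNzRingType) K (p_ : 'I_K -> nat)
    (B_ : forall k, 'M[R]_(p_ k)) :
  \det (\mxdiag_k B_ k) = \prod_k \det (B_ k).
Proof.
elim: K => [|K IH] in p_ B_ *.
  rewrite [RHS]big_ord0; move: (mxdiag _).
  have -> : (\sum_(k < 0) p_ k)%N = 0%N by rewrite big_ord0.
  exact: det_mx00.
by rewrite mxdiag_recl det_castmx det_ublock big_ord_recl IH.
Qed.

Lemma char_poly_mxdiag (R : comNzRingType) K (p_ : 'I_K -> nat)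
    (B_ : forall k, 'M[R]_(p_ k)) :
  char_poly (\mxdiag_k B_ k) = \prod_k char_poly (B_ k).
Proof.
rewrite /char_poly -det_mxdiag /char_poly_mx -mxdiagZ.
congr (\det _); rewrite mxdiagB; congr (_ - _).
rewrite /mxdiag; apply/matrixP => i j; rewrite !mxE.
case: eqP => [e|_]; last by rewrite !mxE.
by case: _ / e (tagnat.sig2 j) => l; rewrite !conform_mx_id !mxE.
Qed.

(** The two sizes, later a group order and a sum of block sizes, are equal without being
    convertible, so the change of basis is a pair of rectangular matrices. *)
Lemma char_poly_similar (R : comNzRingType) m n (A : 'M[R]_m) (B : 'M[R]_n)
    (P : 'M[R]_(m, n)) (Q : 'M[R]_(n, m)) :
  m = n -> P *m Q = 1%:M -> A *m P = P *m B -> char_poly A = char_poly B.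
Proof.
move=> emn; case: n / emn in B P Q *.
move=> PQ AP; have QP := mulmx1C PQ.
have -> : A = P *m B *m Q by rewrite -AP -mulmxA PQ mulmx1.
pose P' := map_mx polyC P; pose Q' := map_mx polyC Q.
have PQ' : P' *m Q' = 1%:M by rewrite -map_mxM PQ map_mx1.
rewrite /char_poly; suff -> : char_poly_mx (P *m B *m Q)
   = P' *m char_poly_mx B *m Q'.
  by rewrite !det_mulmx mulrAC -det_mulmx PQ' det1 mul1r.
rewrite /char_poly_mx mulmxBr mulmxBl !map_mxM.
by rewrite scalar_mxC -[_%:M *m _ *m _]mulmxA PQ' mulmx1.
Qed.

(** The columns of [P_ k] span a subspace stable under [A]. By the size count and the resolution of
    the identity, the [P_ k] side by side form an invertible matrix whose inverse stacks the
    [Q_ k]. *)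
Lemma char_poly_blocks (R : comNzRingType) (I : finType) m n (A : 'M[R]_m)
    (B_ : I -> 'M[R]_n) (P_ : I -> 'M[R]_(m, n)) (Q_ : I -> 'M[R]_(n, m)) :
    m = (#|I| * n)%N -> \sum_k P_ k *m Q_ k = 1%:M ->
    (forall k, A *m P_ k = P_ k *m B_ k) ->
  char_poly A = \prod_k char_poly (B_ k).
Proof.
move=> em PQ AP.
rewrite (reindex (@enum_val I predT)) /=; last first.
  by apply: onW_bij; exact: enum_val_bij.
rewrite -(char_poly_mxdiag (fun k => B_ (enum_val k))).
apply: (@char_poly_similar _ _ _ _ _ (\mxrow_(k < #|I|) P_ (enum_val k))
   (\mxcol_k Q_ (enum_val k))).
- by rewrite sum_nat_const card_ord.
- rewrite mul_mxrow_mxcol -PQ [RHS](reindex (@enum_val I predT)) //=.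
  by apply: onW_bij; exact: enum_val_bij.
- rewrite mul_mxrow_mxdiag mul_mxrow; apply: eq_mxrow => k; exact: AP.
Qed.

(** In size at least 2, column 0 can be nonzero only in the first and last rows, and the two minors
    in its expansion are triangular. *)
Lemma det_cycle (R : comNzRingType) n (a : 'I_n.+1 -> R) :
  \det (\matrix_(i, j) (a i *+ (i == j) - (i.+1 == j %[mod n.+1])%:R))
  = \prod_i a i - 1.
Proof.
set A := \matrix_(i, j) _.
have AE i j : A i j = a i *+ (i == j) - ((i.+1 %% n.+1)%N == j)%:R.
  by rewrite mxE [(j %% _)%N]modn_small.
case: n => [|n] in a A AE *.
  by rewrite det_mx11 big_ord1 AE.
rewrite (expand_det_col A 0) big_ord_recl big_ord_recr.
rewrite big1 => [|i _] /=; last first.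
  rewrite AE /= /bump /= add1n modn_small ?ltnS ?ltn_ord //=.
  by rewrite subr0 mul0r.
have ne_n (i j : 'I_n.+1) : ((i.+2 %% n.+2)%N == j.+1) = (i.+1 == j).
  have [->|ne] := eqVneq i ord_max.
    by rewrite /= modnn [RHS]gtn_eqF.
  by rewrite modn_small ?eqSS // !ltnS ltn_neqAle ne leq_ord.
rewrite !AE /= /bump /= add1n modnn subr0 mulr1n add0r mulr0n.
rewrite sub0r mulN1r; congr (_ - _).
  rewrite big_ord_recl; congr (_ * _).
  rewrite /cofactor mul1r -det_tr det_trig; last first.
    apply/is_trig_mxP => i j ij; rewrite mxE 2!mxE AE.
    rewrite (inj_eq lift_inj) gt_eqF // mulr0n sub0r.
    by rewrite /= /bump /= !add1n ne_n gtn_eqF ?oppr0 // ltnW.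
  apply: eq_bigr => i _; rewrite mxE 2!mxE AE eqxx.
  by rewrite /= /bump /= add1n ne_n gtn_eqF // mulr0n subr0.
(* The last row index, in the form left by splitting the sum; its minor is lower triangular with -1
   on the diagonal. *)
pose m : 'I_n.+2 := fintype.lift ord0 ord_max.
have drop_max (i j : 'I_n.+1) :
    A (fintype.lift m i) (fintype.lift 0 j) =
    a (fintype.lift m i) *+ (i == j.+1 :> nat) - (i == j)%:R.
  rewrite AE -val_eqE /= /bump /= leqNgt ltn_ord add0n !add1n.
  by rewrite modn_small // ltnS.
rewrite /cofactor det_trig; last first.
  apply/is_trig_mxP => i j ij; rewrite 2!mxE drop_max.
  by rewrite -val_eqE !ltn_eqF ?subr0 // ltnS ltnW.
rewrite (eq_bigr (fun=> -1)) => [|i _]; last first.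
  by rewrite 2!mxE drop_max eqxx ltn_eqF // sub0r.
(* The sign of the cofactor and the minor itself are both (-1)^(n+1), so the cofactor is 1. *)
rewrite prodr_const card_ord /= /bump /= add1n addn0.
by rewrite -exprMn mulN1r opprK expr1n.
Qed.

(** * Products over roots of unity and the multiplicity of the root 0 *)

(* The library has this for [algC] only ([C_prim_root_exists]). *)
Lemma closed_prim_root_exists (C : numClosedFieldType) n :
  (0 < n)%N -> {z : C | n.-primitive_root z}.
Proof.
pose p : {poly C} := 'X^n - 1; have [r Dp] := closed_field_poly_normal p.
move=> n_gt0; apply/sigW; rewrite (monicP _) ?monicXnsubC // scale1r in Dp.
have rn1: all n.-unity_root r by apply/allP=> z; rewrite -root_prod_XsubC -Dp.
have sz_r: (n < (size r).+1)%N.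
  by rewrite -(size_prod_XsubC r id) -Dp size_XnsubC.
have [|z] := hasP (has_prim_root n_gt0 rn1 _ sz_r); last by exists z.
by rewrite -separable_prod_XsubC -Dp separable_Xn_sub_1 // pnatr_eq0 -lt0n.
Qed.

(** For odd [m] the right side is X^m - (-w)^m, whose roots are the [m] distinct numbers -w z^x. *)
Lemma prod_XaddC_prim_root (F : fieldType) m (z w : F) :
  m.-primitive_root z -> odd m -> w != 0 ->
  \prod_(0 <= x < m) ('X + (w * z ^+ x)%:P) = 'X^m + (w ^+ m)%:P.
Proof.
move=> zP m_odd w0; have m_gt0 := prim_order_gt0 zP.
have -> : 'X^m + (w ^+ m)%:P = 'X^m - ((- w) ^+ m)%:P.
  by rewrite exprNn -signr_odd m_odd mulN1r polyCN opprK.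
pose rs := [seq - (w * z ^+ x) | x <- iota 0 m].
rewrite [RHS](@all_roots_prod_XsubC _ _ rs).
- rewrite (monicP _) ?monicXnsubC // scale1r big_map /index_iota subn0.
  by apply: eq_bigr => x _; rewrite polyCN opprK.
- by rewrite size_XnsubC // size_map size_iota.
- apply/allP=> _ /mapP[x _ ->]; rewrite rootE !hornerE -mulNr exprMn.
  by rewrite exprAC (prim_expr_order zP) expr1n mulr1 subrr.
rewrite uniq_rootsE map_inj_in_uniq ?iota_uniq // => x y.
rewrite !mem_iota !add0n /= => xm ym /oppr_inj/(mulfI w0)/eqP.
by rewrite (eq_prim_root_expr zP) !modn_small // => /eqP.
Qed.

(** With Y = X^m + w, the difference Y^k - w^k is X^m times a sum whose value at 0 is k w^(k-1),
    nonzero in characteristic 0. *)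
Lemma mup0_pow_sub (F : numFieldType) m k (w : F) :
  (0 < m)%N -> (0 < k)%N -> w ^+ k = 1 -> mup 0 (('X^m + w%:P) ^+ k - 1) = m.
Proof.
move=> m_gt0 k_gt0 wk; have w0 : w != 0.
  apply: contraTneq k_gt0 => w0; case: k wk => // k /eqP.
  by rewrite w0 expr0n eq_sym oner_eq0.
rewrite -[1]/(1%:P) -wk polyC_exp subrXX addrK mupMl; last first.
  rewrite rootE horner_sum.
  rewrite (eq_bigr (fun=> w ^+ k.-1)) => [|j _].
    rewrite sumr_const card_ord -mulr_natr.
    by rewrite mulf_neq0 ?expf_neq0 ?pnatr_eq0 -?lt0n.
  rewrite !hornerE expr0n gtn_eqF // add0r -exprD; congr (_ ^+ _).
  by rewrite subnK // -ltnS prednK.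
by rewrite -['X]subr0 -polyC0 mup_XsubCX eqxx.
Qed.

(** Since [z ^+ c] has order m = n / gcd(c, n), the factors run through gcd(c, n) full periods of
    [prod_XaddC_prim_root]. *)
Lemma mup0_twisted_cycle (F : numFieldType) n (z : F) c d :
  n.-primitive_root z -> odd n ->
  mup 0 (\prod_(x < n) ('X + (z ^+ (c * x + d))%:P) - 1) = (n %/ gcdn c n)%N.
Proof.
move=> zP n_odd; have n_gt0 := prim_order_gt0 zP.
set m := (n %/ gcdn c n)%N.
have zcP : m.-primitive_root (z ^+ c) := exp_prim_root zP c.
have mg : (gcdn c n * m = n)%N by rewrite mulnC divnK // dvdn_gcdr.
have m_odd : odd m by move: n_odd; rewrite -mg oddM => /andP[].
have g_gt0 : (0 < gcdn c n)%N by rewrite gcdn_gt0 n_gt0 orbT.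
have w0 : z ^+ d != 0 by rewrite expf_neq0 // (prim_root_eq0 zP) -lt0n.
rewrite -[RHS](@mup0_pow_sub F _ (gcdn c n) ((z ^+ d) ^+ m)) //; last first.
- by rewrite -exprM mulnC mg -exprM mulnC exprM (prim_expr_order zP) expr1n.
- exact: prim_order_gt0 zcP.
congr (mup 0 (_ - 1)).
rewrite -(prod_XaddC_prim_root zcP) //.
rewrite -(big_mkord xpredT (fun x => 'X + (z ^+ (c * x + d))%:P)).
(* The index is split as j m + x; the part j m contributes z^(c j m) = 1. *)
rewrite -{1}mg big_nat_mul.
rewrite -[in RHS](card_ord (gcdn c n)) -prodr_const big_mkord.
apply: eq_bigr => j _.
rewrite -{1}[(j * m)%N]add0n big_addn mulSn addnK; apply: eq_bigr => x _.
rewrite exprD mulrC mulnDr exprD; congr ('X + (_ * _)%:P).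
rewrite exprM [(c * _)%N]mulnCA exprM exprAC !exprM.
rewrite [z ^+ j ^+ c]exprAC [_ ^+ j ^+ m]exprAC (prim_expr_order zcP).
by rewrite expr1n mulr1.
Qed.

(** * The sum of the additive orders modulo a prime power *)

Section OrderSum.
Local Open Scope nat_scope.

(** From i to i + 1, the multiples of p reproduce the previous sum, and the (p - 1) p^i other
    classes have full order p^(i+1). The factor p + 1 clears the denominator of the closed form. *)
Lemma sum_additive_order_pexp p i : prime p ->
  p.+1 * (\sum_(c < p ^ i) p ^ i %/ gcdn c (p ^ i)) = (p ^ i.*2.+1).+1.
Proof.
move=> p_pr; have p_gt0 := prime_gt0 p_pr.
elim: i => [|i IH]; first by rewrite big_ord1 muln1.
rewrite -(big_mkord xpredT (fun c => p ^ i.+1 %/ gcdn c (p ^ i.+1))).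
rewrite {1}expnSr big_nat_mul big_mkord.
have row (j : 'I_(p ^ i)) :
    \sum_(j * p <= c < j.+1 * p) p ^ i.+1 %/ gcdn c (p ^ i.+1) =
    p ^ i %/ gcdn j (p ^ i) + p.-1 * p ^ i.+1.
  rewrite big_ltn; last by rewrite mulSn -[X in X < _]add0n ltn_add2r.
  congr (_ + _).
    by rewrite expnS [j * p]mulnC -muln_gcdr divnMl.
  rewrite big_nat (eq_bigr (fun=> p ^ i.+1)) => [|c /andP[jc cj]].
    by rewrite -big_nat sum_nat_const_nat mulSn subnS addnK.
  have -> : gcdn c (p ^ i.+1) = 1; last by rewrite divn1.
  apply/eqP; rewrite -/(coprime _ _) coprimeXr // coprime_sym prime_coprime //.
  (* A multiple of [p] would lie strictly between j p and (j + 1) p. *)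
  apply/negP => /dvdnP[q cq]; move: jc cj; rewrite cq ltn_mul2r p_gt0.
  by rewrite ltn_mul2r p_gt0 /= => jq; rewrite ltnS leqNgt jq.
rewrite (eq_bigr _ (fun j _ => row j)) big_split /= sum_nat_const card_ord.
have -> : p ^ i * (p.-1 * p ^ i.+1) = p.-1 * p ^ i.*2.+1.
  by rewrite mulnCA -expnD addnS addnn.
rewrite mulnDr IH doubleS [p ^ i.*2.+3]expnS [p ^ i.*2.+2]expnS.
(* Writing [p] as a successor removes the truncated subtraction; what remains is t + 1 + (p + 1)(p -
   1) t = p^2 t + 1. *)
move: (p ^ i.*2.+1) => t; rewrite -(prednK p_gt0) /=.
ring.
Qed.

End OrderSum.

(** * Matrix coordinates on the Heisenberg group *)

Section HeisenbergCoordinates.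
Variable R : comUnitRingType.
Implicit Types (x y z : R) (g h : heis R).

Definition unitri_mx x y z : 'M[R]_3 :=
  mx_of_rows [:: [:: 1; x; z]; [:: 0; 1; y]; [:: 0; 0; 1]].

Lemma unitri_mx0 : unitri_mx 0 0 0 = 1%:M.
Proof.
apply/matrixP => i j; rewrite !mxE.
by case: i => [[|[|[|]]]] //= ?; case: j => [[|[|[|]]]].
Qed.

Lemma mul_unitri_mx x y z x' y' z' :
  unitri_mx x y z *m unitri_mx x' y' z' =
  unitri_mx (x + x') (y + y') (z + z' + x * y').
Proof.
apply/matrixP => i j; rewrite !mxE !big_ord_recr big_ord0 /= !mxE /=.
by case: i => [[|[|[|]]]] //= ?; case: j => [[|[|[|]]]] //= ?; ring.
Qed.

Lemma invmx_unitri_mx x y z :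
  invmx (unitri_mx x y z) = unitri_mx (- x) (- y) (x * y - z).
Proof.
have VM : unitri_mx (- x) (- y) (x * y - z) *m unitri_mx x y z = 1%:M.
  by rewrite mul_unitri_mx -unitri_mx0; congr unitri_mx; ring.
have [_ U] := mulmx1_unit VM.
by apply: (can_inj (mulmxK U)); rewrite mulVmx.
Qed.

Definition heis_x g := heis_mx g 0 1.
Definition heis_y g := heis_mx g 1 ord_max.
Definition heis_z g := heis_mx g 0 ord_max.

(** Membership in [generated] means membership in every subgroup containing the generators; the
    unitriangular matrices form one. *)
Lemma heis_mxE g : heis_mx g = unitri_mx (heis_x g) (heis_y g) (heis_z g).
Proof.
pose H : {pred gl_group 3 R} :=
  [pred k | `[< exists x y z, glval k = unitri_mx x y z >]].
have Hgen : {subset [:: @gl_a R; @gl_b R] <= H}.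
  move=> k; rewrite mem_seq2 => /orP[] /eqP ->; apply/asboolP.
    by exists 1, 0, 0.
  by exists 0, 1, 0.
have Hclosed : group_closed H.
  split; first by apply/asboolP; exists 0, 0, 0; rewrite unitri_mx0.
  move=> k l /asboolP[x [y [z kE]]] /asboolP[x' [y' [z' lE]]]; apply/asboolP.
  (* The coordinates of k l^-1, since [group_closed] asks for closure under division. *)
  exists (x - x'), (y - y'), (z + (x' * y' - z') - x * y').
  by rewrite /= kE lE invmx_unitri_mx mul_unitri_mx mulrN.
have gP : genval g \in Defs.generated [:: @gl_a R; @gl_b R] := valP g.
have /asboolP[x [y [z E]]] : genval g \in H by move/asboolP: gP; exact.
by rewrite /heis_x /heis_y /heis_z {1}/heis_mx /heis_mx E !mxE.
Qed.

Lemma heis_coordM g h :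
  [/\ heis_x (g * h)%g = heis_x g + heis_x h,
      heis_y (g * h)%g = heis_y g + heis_y h
    & heis_z (g * h)%g = heis_z g + heis_z h + heis_x g * heis_y h].
Proof.
rewrite {1}/heis_x {1}/heis_y {1}/heis_z heis_mxM (heis_mxE g) (heis_mxE h).
by rewrite mul_unitri_mx !mxE.
Qed.

Lemma heis_coord1 :
  [/\ heis_x 1%g = 0 :> R, heis_y 1%g = 0 :> R & heis_z 1%g = 0 :> R].
Proof. by rewrite /heis_x /heis_y /heis_z heis_mx1 !mxE. Qed.

Lemma heis_coord_a :
  [/\ heis_x heis_a = 1 :> R, heis_y heis_a = 0 :> R & heis_z heis_a = 0 :> R].
Proof. by rewrite /heis_x /heis_y /heis_z /heis_mx !mxE. Qed.

Lemma heis_coord_b :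
  [/\ heis_x heis_b = 0 :> R, heis_y heis_b = 1 :> R & heis_z heis_b = 0 :> R].
Proof. by rewrite /heis_x /heis_y /heis_z /heis_mx !mxE. Qed.

(** The element is c^z b^y a^x with c the commutator of a and b: each b enters while x is still 0,
    so no cross term alters z. Natural coordinates already reach all residues. *)
Lemma heis_coord_surj (x y z : nat) :
  exists g,
    [/\ heis_x g = x%:R :> R, heis_y g = y%:R :> R & heis_z g = z%:R :> R].
Proof.
have [xa ya za] := heis_coord_a; have [xb yb zb] := heis_coord_b.
have [c cE] : exists c : heis R, heis_mx c = unitri_mx 0 0 1.
  exists (heis_a * heis_b * (heis_b * heis_a)^-1)%g.
  rewrite heis_mxM heis_mxV !heis_mxM !heis_mxE xa ya za xb yb zb.
  rewrite !mul_unitri_mx invmx_unitri_mx mul_unitri_mx.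
  by congr unitri_mx; ring.
have [xc yc zc] : [/\ heis_x c = 0, heis_y c = 0 & heis_z c = 1].
  by rewrite /heis_x /heis_y /heis_z cE !mxE.
elim: x => [|x [g [xg yg zg]]].
  elim: y => [|y [g [xg yg zg]]].
    elim: z => [|z [g [xg yg zg]]].
      by exists 1%g; exact: heis_coord1.
    exists (g * c)%g; have [-> -> ->] := heis_coordM g c.
    by rewrite xg yg zg xc yc zc; split; rewrite ?mulrSr; ring.
  exists (g * heis_b)%g; have [-> -> ->] := heis_coordM g heis_b.
  by rewrite xg yg zg xb yb zb; split; rewrite ?mulrSr; ring.
exists (g * heis_a)%g; have [-> -> ->] := heis_coordM g heis_a.
by rewrite xg yg zg xa ya za; split; rewrite ?mulrSr; ring.
Qed.

End HeisenbergCoordinates.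

(** * The congruence subgroup and its cosets in coordinates *)

Section CongruenceCoordinates.
Variable n : nat.
Implicit Types g h : heis int.

Lemma mem_congruence g : (g \in congruence n) =
  [&& (n %| heis_x g)%Z, (n %| heis_y g)%Z & (n %| heis_z g)%Z].
Proof.
apply/asboolP/and3P => [[M gM]|[/dvdzP[x gx] /dvdzP[y gy] /dvdzP[z gz]]].
  split; rewrite /heis_x /heis_y /heis_z gM !mxE add0r natz; exact: dvdz_mulr.
exists (mx_of_rows [:: [:: 0; x; z]; [:: 0; 0; y]; [:: 0; 0; 0]]).
rewrite heis_mxE gx gy gz; apply/matrixP => i j; rewrite !mxE natz.
by case: i => [[|[|[|]]]] //= ?; case: j => [[|[|[|]]]] //= ?; ring.
Qed.

(** With h = g k, the cross term x(g) y(k) in z(h) is divisible by [n] as soon as y(k) is, so cosets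
    are compared coordinatewise although z is not additive. *)
Lemma congruence_coordP g h :
  reflect [/\ heis_x g = heis_x h %[mod n], heis_y g = heis_y h %[mod n]
            & heis_z g = heis_z h %[mod n]]%Z
    (g^-1 * h \in congruence n)%g.
Proof.
set k := (g^-1 * h)%g; have -> : h = (g * k)%g by rewrite mulKVg.
have [-> -> ->] := heis_coordM g k.
have modDr (u v : int) : (u = u + v %[mod n])%Z <-> (n %| v)%Z.
  have -> : (n %| v)%Z = (u == u + v %[mod n])%Z.
    by rewrite eq_sym eqz_mod_dvd addrC addKr.
  by split=> /eqP.
rewrite mem_congruence; apply: (iffP and3P) => -[].
  move=> kx ky kz; rewrite -addrA; split; apply/modDr => //.
  by rewrite rpredD // dvdz_mull.
rewrite -addrA => /modDr kx /modDr ky /modDr kz; split=> //.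
by move: kz; rewrite rpredDr // dvdz_mull.
Qed.

End CongruenceCoordinates.

(** * Multiplicities of products, and exponential sums *)

Lemma mup_prod (F : fieldType) (I : finType) (x : F) (P : I -> {poly F}) :
  (forall k, P k != 0) -> mup x (\prod_k P k) = (\sum_k mup x (P k))%N.
Proof.
(* Nonvanishing of the product is carried through the induction for the use of [mupM]. *)
move=> P0; suff [] : mup x (\prod_k P k) = (\sum_k mup x (P k))%N
    /\ \prod_k P k != 0 by [].
elim/big_rec2: _ => [|k y q _ [<- q0]].
  by rewrite mupNroot ?root1 ?oner_eq0.
by rewrite mupM ?mulf_neq0.
Qed.

Section RootExponent.
Variables (F : fieldType) (n : nat) (w : F).
Hypothesis wP : n.-primitive_root w.

Let w0 : w != 0.
Proof. by rewrite (prim_root_eq0 wP) -lt0n (prim_order_gt0 wP). Qed.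

Lemma prim_rootz_mod (k l : int) : (k = l %[mod n])%Z -> w ^ k = w ^ l.
Proof.
move=> kl; rewrite (divz_eq k n) (divz_eq l n) kl !expfzDr //.
rewrite ![(_ * n%:Z)%R]mulrC -!exprz_exp.
by rewrite -!exprnP (prim_expr_order wP) !exp1rz.
Qed.

Lemma prim_rootz_eq1 (k : int) : (w ^ k == 1) = (n %| k)%Z.
Proof.
have n0 : n%:Z != 0 by rewrite -lt0n (prim_order_gt0 wP).
rewrite (@prim_rootz_mod k (k %% n)%Z) ?modz_mod //.
rewrite -[(k %% n)%Z]gez0_abs ?modz_ge0 // -exprnP -(prim_order_dvd wP).
have -> : (n %| k)%Z = (n %| (k %% n)%Z)%Z.
  by apply/dvdz_mod0P/dvdz_mod0P; rewrite modz_mod.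
by rewrite dvdzE !absz_nat.
Qed.

(** A geometric sum: if w^k is not 1, multiplying by w^k - 1 gives w^(k n) - 1 = 0. *)
Lemma sum_prim_rootz (k : int) :
  \sum_(c < n) w ^ (c%:Z * k) = (n %| k)%Z%:R * n%:R.
Proof.
rewrite -prim_rootz_eq1; under eq_bigr do rewrite mulrC -exprz_exp -exprnP.
have [->|ne] := eqVneq (w ^ k) 1.
  by under eq_bigr do rewrite expr1n; rewrite sumr_const card_ord mul1r.
apply: (mulfI (_ : w ^ k - 1 != 0)); first by rewrite subr_eq0.
rewrite -subrX1 mul0r mulr0 exprnP exprz_exp mulrC -exprz_exp -exprnP.
by rewrite (prim_expr_order wP) exp1rz subrr.
Qed.

End RootExponent.

(** * Coordinates and cardinality of the finite quotient *)

Lemma absz_modz_lt (k : int) n : (0 < n)%N -> (`|(k %% n)%Z| < n)%N.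
Proof.
move=> n_gt0; have n0 : n%:Z != 0 by rewrite -lt0n.
by rewrite -ltz_nat gez0_abs ?modz_ge0 // ltz_pmod.
Qed.

Section QuotientCoordinates.
Variables (n : nat) (n_gt0 : (0 < n)%N).
Local Notation Q := (heis_quo n_gt0 : finGroupType).
Implicit Types u v : Q.

(** Coordinates of a chosen representative, meaningful only modulo [n]. *)
Definition quo_x u := heis_x (repr u).
Definition quo_y u := heis_y (repr u).
Definition quo_z u := heis_z (repr u).

Lemma quo_coord_inj u v :
  (quo_x u = quo_x v %[mod n])%Z -> (quo_y u = quo_y v %[mod n])%Z ->
  (quo_z u = quo_z v %[mod n])%Z -> u = v.
Proof.
move=> ex ey ez; rewrite -(quot_projK u) -(quot_projK v).
by apply/quot_projP/congruence_coordP.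
Qed.

Lemma quo_coord_proj g (u := quot_proj (congruence n) g : Q) :
  [/\ quo_x u = heis_x g %[mod n], quo_y u = heis_y g %[mod n]
    & quo_z u = heis_z g %[mod n]]%Z.
Proof. by apply/congruence_coordP/quot_projP; rewrite quot_projK. Qed.

Lemma quo_coordMr u g (v := (u * (quot_proj (congruence n) g : Q))%g) :
  [/\ quo_x v = quo_x u + heis_x g %[mod n],
      quo_y v = quo_y u + heis_y g %[mod n]
    & quo_z v = quo_z u + heis_z g + quo_x u * heis_y g %[mod n]]%Z.
Proof.
have -> : v = quot_proj (congruence n) (repr u * g)%g.
  by rewrite quot_projM quot_projK.
have [-> -> ->] := quo_coord_proj (repr u * g)%g.
by have [-> -> ->] := heis_coordM (repr u) g.
Qed.

Lemma card_heis_quo : #|Q| = (n * n * n)%N.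
Proof.
have n0 : n%:Z != 0 by rewrite -lt0n.
pose md (k : int) := Ordinal (absz_modz_lt k n_gt0).
have md_inj (k l : int) :
    `|(k %% n)%Z|%N = `|(l %% n)%Z|%N -> (k = l %[mod n])%Z.
  by move=> e; rewrite -[LHS]gez0_abs ?modz_ge0 // e gez0_abs ?modz_ge0.
pose f u := (md (quo_x u), md (quo_y u), md (quo_z u)).
have f_inj : injective f.
  by move=> u v [] /md_inj ex /md_inj ey /md_inj ez; exact: quo_coord_inj.
rewrite -(card_codom f_inj) -[in RHS](card_ord n) -!card_prod.
apply: eq_card => -[[x y] z]; rewrite !inE; apply/codomP.
have [g [gx gy gz]] := heis_coord_surj int x y z.
exists (quot_proj (congruence n) g : Q).
have md_mod k l : (k = l %[mod n])%Z -> md k = md l.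
  by move=> kl; apply: val_inj; rewrite /= kl.
have [/md_mod ex /md_mod ey /md_mod ez] := quo_coord_proj g.
have mdK (i : 'I_n) : md i%:R = i.
  by apply: val_inj; rewrite /= natz modz_nat absz_nat modn_small.
by rewrite /f ex ey ez gx gy gz !mdK.
Qed.

End QuotientCoordinates.

(** * Matrices of right multiplication *)

(** A column is a function on [Q]; row u of the matrix has its only 1 at u * f g, so the product
    translates the argument. *)
Lemma mul_rmul_mx (R : comNzRingType) (G : groupType) (Q : finGroupType)
    (f : G -> Q) (g : G) k (F : Q -> 'I_k -> R) :
  map_mx intr (rmul_mx f g) *m (\matrix_(i, j) F (enum_val i) j) =
  \matrix_(i, j) F (enum_val i * f g)%g j.
Proof.
apply/matrixP => i j; rewrite !mxE (bigD1 (enum_rank (enum_val i * f g)%g)) //=.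
rewrite !mxE enum_rankK eqxx mul1r big1 ?addr0 // => l ne.
rewrite !mxE; case: eqP => [e|_]; last by rewrite mul0r.
by rewrite -e enum_valK eqxx in ne.
Qed.

Lemma mul_group_ring_mxB (R : comNzRingType) (G : groupType) (Q : finGroupType)
    (f : G -> Q) (g h : G) k (F : Q -> 'I_k -> R) :
  map_mx intr (group_ring_mx f (<< g >> - << h >>)) *m
    (\matrix_(i, j) F (enum_val i) j) =
  \matrix_(i, j) (F (enum_val i * f g)%g j - F (enum_val i * f h)%g j).
Proof.
rewrite /group_ring_mx lift_is_additive !liftU !scale1r map_mxB mulmxBl.
by rewrite !mul_rmul_mx; apply/matrixP => i j; rewrite !mxE.
Qed.

(** * The blocks: cyclic shift minus a diagonal of roots of unity *)

Section TwistedCycle.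
Variables (F : fieldType) (n : nat) (w : F).
Hypothesis wP : n.-primitive_root w.

Definition twisted_cycle (c d : nat) : 'M[F]_n :=
  \matrix_(x, y) ((x.+1 == y %[mod n])%:R - w ^+ (c * x + d) *+ (x == y)).

(** X - (shift - diagonal) is (X + diagonal) - shift, the shape of [det_cycle]. *)
Lemma char_poly_twisted_cycle c d :
  char_poly (twisted_cycle c d) =
  \prod_(x < n) ('X + (w ^+ (c * x + d))%:P) - 1.
Proof.
have := prim_order_gt0 wP; rewrite /twisted_cycle; case: n => // n' _.
rewrite -det_cycle; congr (\det _); apply/matrixP => i j; rewrite !mxE.
by rewrite polyCB !polyCMn mulrnDl opprB addrA.
Qed.

End TwistedCycle.

Lemma modz_lin (c d u v u' v' m : int) :
  (u = u' %[mod m] -> v = v' %[mod m] ->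
   c * u + d * v = c * u' + d * v' %[mod m])%Z.
Proof.
move=> eu ev.
by rewrite -modzDm -modzMmr eu modzMmr -(modzMmr d) ev modzMmr modzDm.
Qed.

Lemma modz_ordE n (k : int) : (0 < n)%N ->
  exists x0 : 'I_n, forall x : 'I_n, (k == x %[mod n])%Z = (x == x0).
Proof.
move=> n_gt0; have n0 : n%:Z != 0 by rewrite -lt0n.
exists (Ordinal (absz_modz_lt k n_gt0)) => x.
rewrite -val_eqE /= modz_nat modn_small // eq_sym.
by rewrite -eqz_nat gez0_abs ?modz_ge0.
Qed.

(** * Fourier decomposition of the group algebra *)

Section HeisenbergSpectrum.
Variables (n : nat) (n_gt0 : (0 < n)%N).
Local Notation Q := (heis_quo n_gt0 : finGroupType).
Variables (F : numFieldType) (w : F).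
Hypothesis wP : n.-primitive_root w.

Local Notation f := (@quot_proj _ (congruence n) : heis int -> Q).

Let w0 : w != 0.
Proof. by rewrite (prim_root_eq0 wP) -lt0n. Qed.

(** For fixed (c, d) these [n] functions of u span those on which left translation by {x = 0} acts
    through the character (c, d) of (z, y). *)
Definition heis_wave (c d : nat) (u : Q) (x : 'I_n) : F :=
  (quo_x u == x %[mod n])%Z%:R * w ^ (c%:Z * quo_z u + d%:Z * quo_y u).

Lemma heis_wave_a c d u x :
  heis_wave c d (u * f heis_a)%g x =
  (quo_x u + 1 == x %[mod n])%Z%:R * w ^ (c%:Z * quo_z u + d%:Z * quo_y u).
Proof.
have [xa ya za] := heis_coord_a int.
have [ex ey ez] := quo_coordMr u heis_a; rewrite /heis_wave.
rewrite ex xa; congr (_ * _); apply: (prim_rootz_mod wP).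
rewrite ya za ?mulr0 !addr0 in ey ez.
exact: modz_lin.
Qed.

(** Right multiplication by b adds 1 to y and x to z, which produces the phase w^(c x + d). *)
Lemma heis_wave_b c d u x :
  heis_wave c d (u * f heis_b)%g x =
  (quo_x u == x %[mod n])%Z%:R * w ^ (c%:Z * quo_z u + d%:Z * quo_y u) *
  w ^+ (c * x + d).
Proof.
have [xb yb zb] := heis_coord_b int.
have [ex ey ez] := quo_coordMr u heis_b; rewrite /heis_wave.
rewrite ?xb ?yb ?zb ?mulr1 ?addr0 in ex ey ez.
rewrite ex; have [xE|_] := eqVneq; last by rewrite !mul0r.
rewrite !mul1r exprnP -expfzDr //; apply: (prim_rootz_mod wP).
rewrite (modz_lin c d ez ey).
(* Regrouped so that [modz_lin] can replace [quo_x u] by [x]. *)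
pose k := c%:Z * quo_z u + d%:Z * quo_y u + d%:Z.
have -> : c%:Z * (quo_z u + quo_x u) + d%:Z * (quo_y u + 1) =
   1 * k + c%:Z * quo_x u by rewrite /k; ring.
rewrite (modz_lin _ _ (erefl (k %% n)%Z) xE) PoszD PoszM.
by congr (_ %% _)%Z; rewrite /k; ring.
Qed.

Lemma heis_wave_eigen c d :
  map_mx intr (group_ring_mx f (<< heis_a >> - << heis_b >>)) *m
    (\matrix_(i, j) heis_wave c d (enum_val i) j) =
  (\matrix_(i, j) heis_wave c d (enum_val i) j) *m twisted_cycle n w c d.
Proof.
rewrite (mul_group_ring_mxB f heis_a heis_b (heis_wave c d)).
apply/matrixP => i y; rewrite !mxE heis_wave_a heis_wave_b.
set u := enum_val i; have [x0 x0E] := modz_ordE (quo_x u) n_gt0.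
have /eqP ux0 : (quo_x u == x0 %[mod n])%Z by rewrite x0E.
(* In row [u] the wave matrix is supported on column [x0], so only row [x0] of the block
   survives. *)
rewrite (bigD1 x0) //= big1 ?addr0 => [|x /negPf ne]; last first.
  by rewrite mxE /heis_wave x0E ne !mul0r.
rewrite !mxE /heis_wave -/u !x0E eqxx mul1r mulrBr -modzDml ux0 modzDml.
rewrite -PoszD !modz_nat eqz_nat addn1 mulrC; congr (_ - _).
by rewrite eq_sym; case: eqP => [->|_]; rewrite ?mulr0 ?mul0r ?mul1r.
Qed.

Definition heis_wave_dual (c d : nat) (x : 'I_n) (u : Q) : F :=
  (quo_x u == x %[mod n])%Z%:R * w ^ - (c%:Z * quo_z u + d%:Z * quo_y u).

(** The sum over x compares first coordinates; the geometric sums over c and d compare z and y, each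
    with a factor [n]. *)
Lemma heis_wave_orthogonal (u v : Q) :
  \sum_(k : 'I_n * 'I_n) \sum_x
    heis_wave k.1 k.2 u x * heis_wave_dual k.1 k.2 x v
  = (n ^ 2)%:R * (u == v)%:R.
Proof.
have [x0 x0E] := modz_ordE (quo_x u) n_gt0.
have /eqP ux0 : (quo_x u == x0 %[mod n])%Z by rewrite x0E.
pose dz := quo_z u - quo_z v; pose dy := quo_y u - quo_y v.
transitivity ((quo_x u == quo_x v %[mod n])%Z%:R *
   \sum_(k : 'I_n * 'I_n) w ^ (k.1%:Z * dz) * w ^ (k.2%:Z * dy)).
  rewrite mulr_sumr; apply: eq_bigr => -[c d] _ /=.
  rewrite (bigD1 x0) //= big1 ?addr0 => [|x /negPf ne]; last first.
    by rewrite /heis_wave x0E ne !mul0r.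
  rewrite /heis_wave /heis_wave_dual x0E eqxx mul1r ux0 eq_sym mulrCA.
  rewrite -!expfzDr //.
  by congr (_ * _ ^ _); rewrite /dz /dy; ring.
rewrite -(pair_big xpredT xpredT
  (fun c d : 'I_n => w ^ (c%:Z * dz) * w ^ (d%:Z * dy))) /=.
under eq_bigr do rewrite -mulr_sumr.
rewrite -mulr_suml !(sum_prim_rootz wP) -!eqz_mod_dvd.
have -> : (u == v) = [&& (quo_x u == quo_x v %[mod n])%Z,
  (quo_z u == quo_z v %[mod n])%Z & (quo_y u == quo_y v %[mod n])%Z].
  apply/eqP/and3P => [->|[/eqP ex /eqP ez /eqP ey]]; first by split.
  exact: quo_coord_inj.
by rewrite -!mulnb natrX !natrM; ring.
Qed.

Lemma char_poly_heis :
  char_poly (map_mx intr (group_ring_mx f (<< heis_a >> - << heis_b >>))) =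
  \prod_(k : 'I_n * 'I_n) char_poly (twisted_cycle n w k.1 k.2).
Proof.
(* The number of characters (c, d); dividing by it turns [heis_wave_orthogonal] into a resolution of
   the identity. *)
pose N : F := (n ^ 2)%:R.
have N0 : N != 0 by rewrite pnatr_eq0 -lt0n expn_gt0 n_gt0.
apply: (@char_poly_blocks _ _ _ _ _
  (fun k : 'I_n * 'I_n => twisted_cycle n w k.1 k.2)
  (fun k => \matrix_(i, j) heis_wave k.1 k.2 (enum_val i) j)
  (fun k => N^-1 *: \matrix_(j, i) heis_wave_dual k.1 k.2 j (enum_val i))).
- by rewrite card_heis_quo card_prod !card_ord.
- apply/matrixP => i j; rewrite summxE.
  under eq_bigr => k _ do rewrite -scalemxAr mxE.
  rewrite -mulr_sumr.
  have -> : (1%:M : 'M[F]_#|Q|) i j =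
      N^-1 * ((n ^ 2)%:R * (enum_val i == enum_val j)%:R).
    by rewrite mxE mulKf // (inj_eq enum_val_inj).
  rewrite -heis_wave_orthogonal; congr (_ * _); apply: eq_bigr => k _.
  by rewrite mxE; apply: eq_bigr => x _; rewrite !mxE.
by move=> [c d]; exact: heis_wave_eigen.
Qed.

(** The multiplicity in block (c, d) does not depend on d, whence the outer factor [n]. *)
Lemma mup0_char_poly_heis : odd n ->
  mup 0 (char_poly
    (map_mx intr (group_ring_mx f (<< heis_a >> - << heis_b >>))
      : 'M[F]_#|Q|)) =
  (n * \sum_(c < n) n %/ gcdn c n)%N.
Proof.
move=> n_odd; rewrite char_poly_heis mup_prod => [|k]; last first.
  exact/monic_neq0/char_poly_monic.
under eq_bigr => k _ do
  rewrite char_poly_twisted_cycle // mup0_twisted_cycle //.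
rewrite -(pair_big xpredT xpredT (fun c d : 'I_n => n %/ gcdn c n)%N) /=.
rewrite big_distrr; apply: eq_bigr => c _.
by rewrite sum_nat_const card_ord.
Qed.

End HeisenbergSpectrum.

(** * The mass of the eigenvalue measure at 0 and its limit *)

Lemma eigenvalue_measure_singleton (R : realType) m (A : 'M[int]_m) (z : R[i]) :
  eigenvalue_measure R A [set z] =
  ((mup z (char_poly (map_mx intr A)))%:R / m%:R)%:E.
Proof.
rewrite /eigenvalue_measure /mscale /= /msum /=.
rewrite /eigenvalues; case: closed_field_poly_normal => s /= Ds.
rewrite (monicP (char_poly_monic _)) scale1r in Ds.
(* No index below [m] falls outside the list, so the default 0 of [nth] is never counted as an
   eigenvalue. *)
have sz : size s = m.
  by apply/eqP; rewrite -eqSS -(size_prod_XsubC s id) -Ds size_char_poly.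
transitivity ((m%:R^-1)%:E * \sum_(k < m) ((s`_k == z)%:R)%:E : \bar R)%E.
  congr (_ * _)%E; apply: eq_bigr => k _; rewrite /= diracE.
  by congr (_%:R%:E); congr nat_of_bool; apply/idP/eqP => [|->]; rewrite inE.
rewrite Ds mu_prod_XsubC -sum1_count natr_sum sumEFin -EFinM mulrC.
congr (_ / _)%:E.
rewrite [RHS]big_mkcond (big_nth 0) sz big_mkord.
by apply: eq_bigr => j _ /=; case: eqP.
Qed.

(** With q = p^i, the multiplicity q (p q^2 + 1) / (p + 1) divided by q^3 is (p + q^-2) / (p + 1);
    q^-2 is written as a geometric sequence in i. *)
Lemma eigenvalue_measure_heis (R : realType) p i (p_pr : prime p) :
  odd p ->
  eigenvalue_measure R (heis_level_mx i p_pr) [set (0 : R[i])] =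
  ((p%:R + (p%:R ^+ 2)^-1 ^+ i) / (p%:R + 1) : R)%:E.
Proof.
move=> p_odd; rewrite eigenvalue_measure_singleton; congr (_)%:E.
have [w wP] := closed_prim_root_exists R[i] (heis_pow_gt0 i p_pr).
have pi_odd : odd (p ^ i) by rewrite oddX p_odd orbT.
have E := mup0_char_poly_heis (heis_pow_gt0 i p_pr) wP pi_odd.
rewrite [X in X%:R / _]E card_heis_quo.
have := sum_additive_order_pexp i p_pr; set S := (\sum_(_ < _) _)%N => ES.
have p0 : p%:R != 0 :> R by rewrite pnatr_eq0 -lt0n prime_gt0.
have p1 : p%:R + 1 != 0 :> R by rewrite natr1 pnatr_eq0.
have q0 : (p%:R : R) ^+ i != 0 by rewrite expf_neq0.
have {}ES : (p%:R + 1) * S%:R = p%:R * (p%:R ^+ i) ^+ 2 + 1 :> R.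
  by rewrite -exprM muln2 -exprS !natr1 -natrX natr1 -natrM ES.
rewrite !natrM.
have -> : S%:R = (p%:R * (p%:R ^+ i) ^+ 2 + 1) / (p%:R + 1) :> R.
  by rewrite -ES mulrAC mulfV // mul1r.
rewrite natrX exprVn [p%:R ^+ 2 ^+ i]exprAC; move: (p%:R ^+ i) q0 => q q0.
by field; rewrite q0 p1.
Qed.

Theorem theorem1p2 (R : realType) (p : nat) (p_pr : prime p) (p_odd : odd p) :
  (fun i : nat =>
     eigenvalue_measure R (heis_level_mx i p_pr) [set (0 : R[i])])
    @ \oo --> (p%:R / (p%:R + 1) : R)%:E.
Proof.
under eq_fun do rewrite eigenvalue_measure_heis //.
(* All values are finite, so the limit may be taken in the reals. *)
apply: cvg_EFin; first by apply: nearW.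
rewrite (_ : fine \o _ = fun i => (p%:R + (p%:R ^- 2) ^+ i) / (p%:R + 1)) //.
apply: cvgMr_tmp.
rewrite -[X in _ --> X]addr0; apply: cvgD; first exact: cvg_cst.
(* The ratio p^-2 has absolute value below 1, so the geometric term vanishes in the limit. *)
apply: cvg_expr; rewrite normfV ger0_norm ?exprn_ge0 //.
rewrite invf_lt1 ?exprn_gt0 ?exprn_egt1 //;
  by rewrite ?ltr0n ?ltr1n ?prime_gt0 ?prime_gt1.
Qed.
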